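(* For $t\in\mathbb{Q}$ put $$x_1(t)=\frac{2t^2-22t-13}{14(t^2+t+1)},\quad x_2(t)=\frac{-13t^2-4t+11}{14(t^2+t+1)},\quad x_3(t)=\frac{11t^2+26t+2}{14(t^2+t+1)}.$$ The $5$-designs with $6$ rational points for the Chebyshev measure $(1-t^2)^{-1/2}dt/\pi$ on $(-1,1)$ are parametrized by these rational functions: every such design is, as a set, $\{\pm x_1(t),\pm x_2(t),\pm x_3(t)\}$ for some $t\in\mathbb{Q}$, and for every $t\in\mathbb{Q}$ the six numbers $x_1(t),x_2(t),x_3(t),-x_1(t),-x_2(t),-x_3(t)$ form such a design whenever they are pairwise distinct.
   Context: An $m$-design with $n$ points for a probability measure $w(t)dt$ on an interval $I$ is a set of $n$ pairwise distinct points $x_1,\dots,x_n\in I$ with $\frac1n\sum_i f(x_i)=\int_I f(t)w(t)dt$ for every real polynomial $f$ of degree at most $m$. The Chebyshev measure is $w(t)=\frac{1}{\pi\sqrt{1-t^2}}$ on $I=(-1,1)$. *)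

(* Defs.v *)
From mathcomp Require Import all_boot all_order all_algebra finmap.
From mathcomp Require Import all_classical all_reals all_analysis.

Set Implicit Arguments.
Unset Strict Implicit.
Unset Printing Implicit Defensive.

Import Order.TTheory GRing.Theory Num.Theory.

Local Open Scope ring_scope.

(* The n points form the finite set X, so they are pairwise distinct. The
   quadrature identity is stated in \bar R: for measurable w, a finite value of the
   Lebesgue integral entails that f * w is integrable on I. Taking f = 1 forces w to
   have total mass 1 on I, so this is not required separately. *)
Definition is_design (R : realType) (I : interval R) (w : R -> R)
    (m n : nat) (X : {fset R}) : Prop :=
  [/\ #|` X|%fset = n,
      (forall x, x \in X -> x \in I) &
      forall f : {poly R}, (size f <= m.+1)%N ->
        ((n%:R^-1 * \sum_(x <- X) f.[x])%:E
         = \int[lebesgue_measure]_(t in [set` I]) (f.[t] * w t)%:E)%E].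

Definition chebyshev_density (R : realType) (t : R) : R :=
  (pi * Num.sqrt (1 - t ^+ 2))^-1.

Definition is_chebyshev_design (R : realType) (m n : nat) (X : {fset R}) :=
  is_design `](-1), 1[ (@chebyshev_density R) m n X.

Definition rational_points (R : realType) (X : {fset R}) : Prop :=
  forall x, x \in X -> exists q : rat, x = ratr q.

Definition x1 (t : rat) : rat :=
  (2 * t ^+ 2 - 22 * t - 13) / (14 * (t ^+ 2 + t + 1)).

Definition x2 (t : rat) : rat :=
  (- 13 * t ^+ 2 - 4 * t + 11) / (14 * (t ^+ 2 + t + 1)).

Definition x3 (t : rat) : rat :=
  (11 * t ^+ 2 + 26 * t + 2) / (14 * (t ^+ 2 + t + 1)).

Definition six_points (t : rat) : seq rat :=
  [:: x1 t; x2 t; x3 t; - x1 t; - x2 t; - x3 t].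

Definition six_point_set (R : realType) (t : rat) : {fset R} :=
  [fset (ratr q : R) | q in six_points t]%fset.

(* Main.v *)
Require Import Defs.
From mathcomp Require Import all_boot all_order all_algebra finmap.
From mathcomp Require Import all_classical all_reals all_analysis measurable_realfun.
From mathcomp Require Import ring lra.

(* If [f = c - t P + (1 - t^2) P'], then [c asin t + sqrt (1 - t^2) P] is an
   antiderivative of [f / sqrt (1 - t^2)], so [f] has Chebyshev mean [c]; this
   gives the mean [f_0 + f_2 / 2 + 3 f_4 / 8] of a polynomial of degree at most 5.

   For a design with six points, the odd power sums of order 1, 3, 5 vanish, so
   by Newton's identities the monic polynomial with these roots is even and the
   points are [{+-a, +-b, +-c}]. The power sums of order 2 and 4 then give
   [(a+b+c)(a+b-c)(a-b+c)(-a+b+c) = 0]; after a change of signs, [a + b + c = 0]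
   and [a^2 + b^2 + c^2 = 3 / 2]. The rational points of this conic are
   [(x1 t, x2 t, x3 t)] together with the value [(1/7, -13/14, 11/14)] at
   [t = oo], which is a permutation of the one at [t = 0]. *)

Set Implicit Arguments.
Unset Strict Implicit.
Unset Printing Implicit Defensive.

Import Order.TTheory GRing.Theory Num.Theory numFieldNormedType.Exports.

Local Open Scope classical_set_scope.
Local Open Scope ring_scope.

(** * Improper integrals, and the arcsine at the endpoints *)

(** The closed intervals [E n] exhaust []a, b[]; on each of them the usual fundamental theorem
    applies, and since [g] is nonnegative, monotone convergence passes to the limit even if [g]
    blows up at the endpoints. *)
Lemma ge0_FTC2_oo (R : realType) (g F : R -> R) (a b A B : R) : a < b ->
  {in `]a, b[, forall x, 0 <= g x} -> {in `]a, b[, continuous g} ->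
  {in `]a, b[, forall x, is_derive x (1 : R) F (g x)} ->
  F x @[x --> a^'+] --> A -> F x @[x --> b^'-] --> B ->
  (\int[lebesgue_measure]_(x in `]a, b[) (g x)%:E = (B - A)%:E)%E.
Proof.
move=> ab g0 cg dF FA FB.
(* As [harmonic n <= 1], the factor [(b - a) / 3] keeps [u n < v n] already at [n = 0]. *)
pose u (n : nat) : R := a + (b - a) / 3 * harmonic n.
pose v (n : nat) : R := b - (b - a) / 3 * harmonic n.
have d0 : 0 < (b - a) / 3 by rewrite divr_gt0 ?subr_gt0.
have h0 n : 0 < @harmonic R n by exact: harmonic_gt0.
have h1 n : @harmonic R n <= 1.
  by rewrite /harmonic invf_le1// ler1n.
have dh0 n : 0 < (b - a) / 3 * harmonic n by rewrite mulr_gt0.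
have dh1 n : (b - a) / 3 * harmonic n <= (b - a) / 3.
  by rewrite ler_piMr// ltW.
have au n : a < u n by rewrite ltrDl.
have vb n : v n < b by rewrite ltrBlDr ltrDl.
have uv n : u n < v n.
  by move: (dh1 n) d0; rewrite /u /v; lra.
have dhh : (fun n => (b - a) / 3 * harmonic n) @ \oo --> (0 : R).
  rewrite -[X in _ --> X](mulr0 ((b - a) / 3)).
  by apply: cvgM; [exact: cvg_cst|exact: cvg_harmonic].
have cu : u @ \oo --> a.
  by rewrite -[X in _ --> X]addr0; apply: cvgD => //; exact: cvg_cst.
have cv : v @ \oo --> b.
  by rewrite -[X in _ --> X]subr0; apply: cvgB => //; exact: cvg_cst.
have hh m n : (m <= n)%N -> (b - a) / 3 * harmonic n <= (b - a) / 3 * harmonic m.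
  by move=> mn; rewrite ler_pM2l// /harmonic lef_pV2 ?posrE ?ltr0n// ler_nat.
pose E n := [set` `[u n, v n]] : set R.
have sub n : E n `<=` `]a, b[.
  rewrite /E => x /=; rewrite !in_itv/= => /andP[ux xv].
  by rewrite (lt_le_trans (au n) ux) (le_lt_trans xv (vb n)).
have bigE : \bigcup_n E n = `]a, b[%classic.
  apply/seteqP; split => [x [n _]|x /=]; first exact: sub.
  rewrite in_itv/= => /andP[ax xb].
  have nu : \forall n \near \oo, u n < x.
    by move/cvgr_lt: cu; apply.
  have nv : \forall n \near \oo, x < v n.
    by move/cvgr_gt: cv; apply.
  have [n [un vn]] := filter_ex (filterI nu nv).
  by exists n => //; rewrite /E /= in_itv/= !ltW.
have mg : measurable_fun `]a, b[ (EFin \o g).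
  apply/measurable_EFinP; apply: open_continuous_measurable_fun.
    exact: itv_open.
  by move=> x; rewrite inE => /cg.
have FE n : (\int[lebesgue_measure]_(x in E n) (g x)%:E = (F (v n) - F (u n))%:E)%E.
  have cF x : x \in `]a, b[ -> {for x, continuous F}.
    by move=> /dF [dFx _]; exact/differentiable_continuous/derivable1_diffP.
  have mem x : x \in `[u n, v n] -> x \in `]a, b[ by exact: sub.
  have memo x : x \in `]u n, v n[ -> x \in `]a, b[.
    by move/subset_itv_oo_cc/mem.
  rewrite (@continuous_FTC2 _ g F)// ?EFinB//.
  - by apply: continuous_in_subspaceT => x; rewrite inE => /mem /cg.
  - split=> [x /memo /dF[]//||].
    + apply/cvg_at_right_filter/cF/mem.
      by rewrite in_itv/= lexx ltW.
    + apply/cvg_at_left_filter/cF/mem.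
      by rewrite in_itv/= lexx ltW.
  - by move=> x /memo /dF dx; rewrite derive1E derive_val.
have FAB : (\int[lebesgue_measure]_(x in E n) (g x)%:E)%E @[n --> \oo] --> (B - A)%:E.
  rewrite (funext FE); apply: cvg_EFin; first by near=> n.
  apply: cvgB; first by move/cvg_at_leftP: FB; apply.
  by move/cvg_at_rightP: FA; apply.
rewrite -bigE; apply/esym/(cvg_unique _ FAB) => //.
apply: ge0_nondecreasing_set_cvg_integral.
- apply/nondecreasing_seqP => n; apply/subsetPset/subset_itv;
    rewrite bnd_simp /u /v; have := hh _ _ (leqnSn n); lra.
- by move=> n; exact: measurable_itv.
- by move=> n; apply: measurable_funS (sub n) mg.
- by move=> n x /sub /g0; rewrite lee_fin.
Unshelve. all: by end_near. Qed.

Lemma asin_cvg_left1 (R : realType) : asin x @[x --> (1 : R)^'-] --> (pi / 2 : R).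
Proof.
apply/cvgrPdist_le => e e0.
have pi0 : 0 < pi :> R by exact: pi_gt0.
(* The bound [d <= pi] keeps [pi / 2 - d] where [sin] is increasing, so [sin (pi / 2 - d) < x] can
   be inverted to [pi / 2 - d < asin x]. *)
have [d [d0 dpi de]] : exists d : R, [/\ 0 < d, d <= pi & d <= e].
  by exists (Num.min e pi); rewrite lt_min e0 pi0 !ge_min !lexx orbT.
have s1 : sin (pi / 2 - d) < 1.
  by rewrite -[ltRHS](@sin_pihalf R) ltr_sin ?in_itv/=; lra.
near=> x.
have x1 : x < 1 by near: x; exact: nbhs_left_lt.
have sx : sin (pi / 2 - d) < x by near: x; exact: nbhs_left_gt.
have xN1 : -1 <= x by apply: le_trans (ltW sx); exact: sin_geN1.
have xb : -1 <= x <= 1 by rewrite xN1 ltW.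
have [/andP[a1 a2] sa] := asin_def xb.
have : pi / 2 - d < asin x.
  by rewrite -ltr_sin ?in_itv/= ?a1 ?a2 ?sa//; lra.
by rewrite ger0_norm; lra.
Unshelve. all: by end_near. Qed.

Lemma asin_cvg_rightN1 (R : realType) :
  asin x @[x --> (-1 : R)^'+] --> (- (pi / 2) : R).
Proof.
apply/cvgrPdist_le => e e0.
have pi0 : 0 < pi :> R by exact: pi_gt0.
have [d [d0 dpi de]] : exists d : R, [/\ 0 < d, d <= pi & d <= e].
  by exists (Num.min e pi); rewrite lt_min e0 pi0 !ge_min !lexx orbT.
have s1 : -1 < sin (- (pi / 2) + d).
  by rewrite -[ltLHS]opprK opprK -[X in - X](@sin_pihalf R) -sinN ltr_sin ?in_itv/=; lra.
near=> x.
have x1 : -1 < x by near: x; exact: nbhs_right_gt.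
have sx : x < sin (- (pi / 2) + d) by near: x; exact: nbhs_right_lt.
have xb : -1 <= x <= 1 by rewrite ltW//= (le_trans (ltW sx))// sin_le1.
have [/andP[a1 a2] sa] := asin_def xb.
have : asin x < - (pi / 2) + d.
  by rewrite -ltr_sin ?in_itv/= ?a1 ?a2 ?sa//; lra.
by rewrite ler0_norm; lra.
Unshelve. all: by end_near. Qed.

Lemma is_derive_sqrtBsqr (R : realType) (t : R) : -1 < t < 1 ->
  is_derive t (1 : R) (fun x : R => Num.sqrt (1 - x ^+ 2))
    (- t / Num.sqrt (1 - t ^+ 2)).
Proof.
move=> /andP[t1 t2]; have s0 : 0 < 1 - t ^+ 2 by nra.
have dp : is_derive t (1 : R) (fun x : R => 1 - x ^+ 2) (- (2 * t)).
  rewrite (_ : (fun x : R => _) = horner (1 - 'X^2)); last first.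
    by apply/funext => x; rewrite !hornerE.
  apply: (is_derive_eq (is_derive_poly _ _)).
  by rewrite !poly.derivE !hornerE; ring.
apply: (is_derive_eq (@is_derive1_comp R Num.sqrt (fun x => 1 - x ^+ 2) t _ _ (is_derive1_sqrt s0) dp)).
by field; rewrite gt_eqF ?sqrtr_gt0.
Qed.

Lemma continuous_sqrtBsqr (R : realType) :
  continuous (fun x : R => Num.sqrt (1 - x ^+ 2)).
Proof.
move=> x; apply: continuous_comp; last exact: sqrt_continuous.
rewrite (_ : (fun x : R => _) = horner (1 - 'X^2)); last first.
  by apply/funext => y; rewrite !hornerE.
exact: continuous_horner.
Qed.

(** * Chebyshev means of polynomials *)

Lemma ge0_integral_chebyshev (R : realType) (f P : {poly R}) (c : R) :
  (forall t, f.[t] = c - t * P.[t] + (1 - t ^+ 2) * P^`().[t]) ->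
  {in `](-1), 1[, forall t, 0 <= f.[t]} ->
  (\int[lebesgue_measure]_(t in `](-1)%R, 1%R[) (f.[t] * chebyshev_density t)%:E
   = c%:E)%E.
Proof.
move=> fE f0; have pi0 : 0 < pi :> R by exact: pi_gt0.
have s0 t : t \in `](-1), 1[ -> 0 < Num.sqrt (1 - t ^+ 2) :> R.
  by rewrite in_itv/= sqrtr_gt0 => /andP[? ?]; nra.
pose F t : R := pi^-1 * (c * asin t + Num.sqrt (1 - t ^+ 2) * P.[t]).
(* At both endpoints [x ^+ 2 = 1] kills the square root term, so only the arcsine contributes; [G]
   stands for either one-sided neighbourhood filter. *)
have endp (x l : R) (G : set_system R) : Filter G -> G `=>` nbhs x ->
    x ^+ 2 = 1 -> asin t @[t --> G] --> l ->
    F t @[t --> G] --> pi^-1 * (c * l).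
  move=> FG Gx x1 al; apply: cvgM; first exact: cvg_cst.
  rewrite -[c * l]addr0; apply: cvgD; first by apply: cvgM => //; exact: cvg_cst.
  have -> : 0 = Num.sqrt (1 - x ^+ 2) * P.[x] by rewrite x1 subrr sqrtr0 mul0r.
  apply: cvgM; first exact: (cvg_trans (cvg_app _ Gx) (@continuous_sqrtBsqr R x)).
  exact: (cvg_trans (cvg_app _ Gx) (@continuous_horner _ P x)).
rewrite (@ge0_FTC2_oo R (fun t => f.[t] * chebyshev_density t) F _ _
    (pi^-1 * (c * - (pi / 2))) (pi^-1 * (c * (pi / 2)))).
- by congr EFin; move: (pi : R) pi0 => p p0; field; rewrite gt_eqF.
- lra.
- move=> t ti; rewrite mulr_ge0 ?f0// invr_ge0 mulr_ge0 ?sqrtr_ge0// ltW//.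
- move=> t ti; apply: cvgM; first exact: continuous_horner.
  apply: cvgV; first by rewrite mulf_neq0// gt_eqF ?s0.
  by apply: cvgM; [exact: cvg_cst|exact: continuous_sqrtBsqr].
- move=> t ti; have tb : -1 < t < 1 by move: ti; rewrite in_itv.
  have dP := is_derive_poly P t.
  have da := is_derive1_asin tb.
  have ds := is_derive_sqrtBsqr tb.
  have ca := is_deriveZ c da.
  have dF : is_derive t (1 : R) F _ :=
    is_deriveZ pi^-1 (is_deriveD ca (is_deriveM ds dP)).
  apply: (is_derive_eq dF); rewrite /chebyshev_density fE /GRing.scale/=.
  have st : Num.sqrt (1 - t ^+ 2) ^+ 2 = 1 - t ^+ 2.
    by rewrite sqr_sqrtr//; have := s0 _ ti; rewrite sqrtr_gt0 => /ltW.
  move: (pi : R) (Num.sqrt _) st pi0 (s0 _ ti) => p s st p0 s0'.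
  by rewrite -st; field; rewrite !gt_eqF.
- apply: endp; [exact: cvg_within|ring|exact: asin_cvg_rightN1].
- apply: endp; [exact: cvg_within|ring|exact: asin_cvg_left1].
Qed.

(** This bound supplies a constant whose addition makes a polynomial nonnegative on [[-1, 1]]. *)
Lemma horner_norm_le_sum (R : realDomainType) (f : {poly R}) (t : R) :
  `|t| <= 1 -> `|f.[t]| <= \sum_(i < size f) `|f`_i|.
Proof.
move=> t1; rewrite horner_coef (le_trans (ler_norm_sum _ _ _))//.
apply: ler_sum => i _; rewrite normrM normrX ler_piMr//.
exact: exprn_ile1.
Qed.

Lemma integral_chebyshev (R : realType) (f P : {poly R}) (c : R) :
  (forall t, f.[t] = c - t * P.[t] + (1 - t ^+ 2) * P^`().[t]) ->
  (\int[lebesgue_measure]_(t in `](-1)%R, 1%R[) (f.[t] * chebyshev_density t)%:E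
   = c%:E)%E.
Proof.
(* Adding a constant [M] to [f] reduces to a nonnegative integrand. *)
move=> fE; pose M := \sum_(i < size f) `|f`_i|.
have M0 : 0 <= M by exact: sumr_ge0.
have w0 (t : R) : 0 <= chebyshev_density t.
  by rewrite invr_ge0 mulr_ge0 ?sqrtr_ge0// ltW// pi_gt0.
have intM : (\int[lebesgue_measure]_(t in `](-1)%R, 1%R[)
    (M%:P.[t] * chebyshev_density t)%:E = M%:E)%E.
  apply: (@ge0_integral_chebyshev _ _ 0) => t; rewrite ?deriv0 !hornerE//.
  ring.
have fM0 : {in `](-1), 1[, forall t, 0 <= (f + M%:P).[t]}.
  move=> t; rewrite in_itv/= hornerD hornerC => tb.
  have : `|t| <= 1 by rewrite ler_norml; lra.
  by move=> /(horner_norm_le_sum f); rewrite ler_norml -/M; lra.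
have intfM : (\int[lebesgue_measure]_(t in `](-1)%R, 1%R[)
    ((f + M%:P).[t] * chebyshev_density t)%:E = (c + M)%:E)%E.
  apply: (@ge0_integral_chebyshev _ _ P) => // t.
  by rewrite hornerD hornerC fE; ring.
have mw (g : {poly R}) : measurable_fun `](-1 : R), (1 : R)[
    (fun t : R => (g.[t] * chebyshev_density t)%:E).
  apply/measurable_EFinP; apply: open_continuous_measurable_fun.
    exact: itv_open.
  move=> t; rewrite inE/= in_itv/= => tb.
  apply: cvgM; first exact: continuous_horner.
  have s0 : 0 < 1 - t ^+ 2 by case/andP: tb => ? ?; nra.
  apply: cvgV; first by rewrite mulf_neq0// gt_eqF ?pi_gt0 ?sqrtr_gt0.
  by apply: cvgM; [exact: cvg_cst|exact: continuous_sqrtBsqr].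
(* A nonnegative measurable function with finite integral is integrable, which permits subtracting
   the two integrals below. *)
have integ (g : {poly R}) (l : R) : {in `](-1), 1[, forall t, 0 <= g.[t]} ->
    (\int[lebesgue_measure]_(t in `](-1)%R, 1%R[)
      (g.[t] * chebyshev_density t)%:E = l%:E)%E ->
    lebesgue_measure.-integrable `](-1 : R), (1 : R)[
      (EFin \o (fun t => g.[t] * chebyshev_density t)).
  move=> g0 gl; apply/integrableP; split; first exact: mw.
  rewrite [ltLHS](_ : _ = l%:E) ?ltry// -gl; apply: eq_integral => t.
  rewrite inE/= => /g0 gt0.
  by rewrite ger0_norm// mulr_ge0.
have /= := integralB_EFin _ (integ _ _ fM0 intfM) (integ _ _ _ intM).
rewrite intM intfM -EFinB addrK => <- //; last first.
  by move=> t _; rewrite hornerC.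
apply: eq_integral => t _; rewrite -EFinB hornerD hornerC; congr EFin; ring.
Qed.

Lemma horner_deg5 (R : comNzRingType) (f : {poly R}) (t : R) :
  (size f <= 6)%N ->
  f.[t] = f`_0 + f`_1 * t + f`_2 * t ^+ 2 + f`_3 * t ^+ 3 + f`_4 * t ^+ 4
          + f`_5 * t ^+ 5.
Proof.
move=> sf; rewrite (horner_coef_wide t sf) !big_ord_recr big_ord0/=.
by rewrite add0r expr0 mulr1 expr1.
Qed.

(** The weights 1, 1/2, 3/8 are the even moments binom(2k, k) / 4^k of the arcsine law. *)
Lemma integral_chebyshev_deg5 (R : realType) (f : {poly R}) :
  (size f <= 6)%N ->
  (\int[lebesgue_measure]_(t in `](-1)%R, 1%R[) (f.[t] * chebyshev_density t)%:E
   = (f`_0 + f`_2 / 2 + 3 * f`_4 / 8)%:E)%E.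
Proof.
move=> sf.
pose p4 := - f`_5 / 5; pose p3 := - f`_4 / 4.
pose p2 := (4 * p4 - f`_3) / 3; pose p1 := (3 * p3 - f`_2) / 2.
pose p0 := 2 * p2 - f`_1.
(* [P] comes from solving the hypothesis of [integral_chebyshev] coefficientwise. *)
apply: (@integral_chebyshev _ _
  (p0%:P + p1 *: 'X + p2 *: 'X^2 + p3 *: 'X^3 + p4 *: 'X^4)) => t.
rewrite (horner_deg5 t sf) !(derivD, derivZ, derivXn, derivX, derivC).
rewrite !(hornerD, hornerZ, hornerMn, hornerX, hornerXn, hornerC)/=.
rewrite /p0 /p1 /p2 /p3 /p4.
by field.
Qed.

(** * Symmetry and power sums *)

(** Negation reverses the order, and a strictly sorted list is determined by its members. *)
Lemma lt_sorted_symmetric (R : realDomainType) (s : seq R) :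
  sorted <%R s -> {in s, forall x, - x \in s} -> s = rev (map -%R s).
Proof.
move=> ss sN; apply: lt_sorted_eq => //.
  rewrite rev_sorted sorted_map; apply: sub_sorted ss => x y /= xy.
  by rewrite ltrN2.
move=> x; rewrite mem_rev; apply/idP/mapP => [/sN xs|[y /sN ys ->//]].
by exists (- x); rewrite ?opprK.
Qed.

(** With six factors the left side is the right side at [- x], so the difference is twice the odd
    part, whose coefficients are elementary symmetric functions of odd order. *)
Lemma odd_power_sums_prod (R : realFieldType) (a b c d e f : R) :
  a + b + c + d + e + f = 0 ->
  a ^+ 3 + b ^+ 3 + c ^+ 3 + d ^+ 3 + e ^+ 3 + f ^+ 3 = 0 ->
  a ^+ 5 + b ^+ 5 + c ^+ 5 + d ^+ 5 + e ^+ 5 + f ^+ 5 = 0 ->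
  forall x, (x + a) * (x + b) * (x + c) * (x + d) * (x + e) * (x + f)
    = (x - a) * (x - b) * (x - c) * (x - d) * (x - e) * (x - f).
Proof.
move=> p1 p3 p5 x.
pose e2 := a * (b + c + d + e + f) + b * (c + d + e + f) + c * (d + e + f)
  + d * (e + f) + e * f.
pose e3 := a * (b * (c + d + e + f) + c * (d + e + f) + d * (e + f) + e * f)
  + b * (c * (d + e + f) + d * (e + f) + e * f)
  + c * (d * (e + f) + e * f) + d * e * f.
pose e4 := a * (b * (c * (d + e + f) + d * (e + f) + e * f)
                + c * (d * (e + f) + e * f) + d * e * f)
  + b * (c * (d * (e + f) + e * f) + d * e * f) + c * d * e * f.
pose e5 := a * (b * (c * (d * (e + f) + e * f) + d * e * f) + c * d * e * f)
  + b * c * d * e * f.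
(* Newton's identities give [3 * e3] and [5 * e5]. *)
have E3 : 3 * e3 = 0.
  transitivity (e2 * (a + b + c + d + e + f)
    - (a + b + c + d + e + f) * (a ^+ 2 + b ^+ 2 + c ^+ 2 + d ^+ 2 + e ^+ 2 + f ^+ 2)
    + (a ^+ 3 + b ^+ 3 + c ^+ 3 + d ^+ 3 + e ^+ 3 + f ^+ 3)).
    by rewrite /e3 /e2; ring.
  by rewrite p1 p3; ring.
have e30 : e3 = 0 by move: E3; clear; lra.
have E5 : 5 * e5 = 0.
  transitivity (e4 * (a + b + c + d + e + f)
    - e3 * (a ^+ 2 + b ^+ 2 + c ^+ 2 + d ^+ 2 + e ^+ 2 + f ^+ 2)
    + e2 * (a ^+ 3 + b ^+ 3 + c ^+ 3 + d ^+ 3 + e ^+ 3 + f ^+ 3)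
    - (a + b + c + d + e + f) * (a ^+ 4 + b ^+ 4 + c ^+ 4 + d ^+ 4 + e ^+ 4 + f ^+ 4)
    + (a ^+ 5 + b ^+ 5 + c ^+ 5 + d ^+ 5 + e ^+ 5 + f ^+ 5)).
    by rewrite /e5 /e4 /e3 /e2; ring.
  by rewrite p1 p3 p5 e30; ring.
have e50 : e5 = 0 by move: E5; clear; lra.
apply/eqP; rewrite -subr_eq0; apply/eqP.
transitivity (2 * ((a + b + c + d + e + f) * x ^+ 5 + e3 * x ^+ 3 + e5 * x)).
  by rewrite /e5 /e3; ring.
by rewrite p1 e30 e50; ring.
Qed.

(** Heron's product of four linear forms is the square of the second power sum minus twice the
    fourth, and [(3 / 2) ^+ 2 = 2 * (9 / 8)]. *)
Lemma power_sums_linear (R : realFieldType) (a b c : R) :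
  a ^+ 2 + b ^+ 2 + c ^+ 2 = 3 / 2 -> a ^+ 4 + b ^+ 4 + c ^+ 4 = 9 / 8 ->
  [\/ a + b + c = 0, a + b - c = 0, a - b + c = 0 | - a + b + c = 0].
Proof.
move=> p2 p4.
have : (a + b + c) * (a + b - c) * (a - b + c) * (- a + b + c) = 0.
  transitivity ((a ^+ 2 + b ^+ 2 + c ^+ 2) ^+ 2 - 2 * (a ^+ 4 + b ^+ 4 + c ^+ 4)).
    ring.
  by rewrite p2 p4; field.
move/eqP; rewrite !mulf_eq0 -!orbA => /or4P[] /eqP ?.
- exact: Or41.
- exact: Or42.
- exact: Or43.
- exact: Or44.
Qed.

(** * Rational parametrization of the conic *)

Lemma conic_param (p q r : rat) :
  p + q + r = 0 -> p ^+ 2 + q ^+ 2 + r ^+ 2 = 3 / 2 ->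
  exists t, [/\ x1 t = p, x2 t = q & x3 t = r] \/
            [/\ x1 t = q, x2 t = r & x3 t = p].
Proof.
move=> pqr p2; have rE : r = - p - q by lra.
rewrite {}rE {pqr} in p2 *.
have {}p2 : p ^+ 2 + p * q + q ^+ 2 = 3 / 4.
  by move: p2; nra.
(* Project the conic from its point [(1 / 7, - 13 / 14)], the value at [t = oo]. *)
pose dx := p - 1 / 7; pose dy := q + 13 / 14.
(* On the parametrized curve [(dx, dy)] is proportional to [(- (8 * t + 5), 3 * t + 8)]; solving for
   [t] gives [N / M]. *)
pose M := 3 * dx + 8 * dy; pose N := - (8 * dx + 5 * dy).
have [M0|M0] := eqVneq M 0.
  (* [M = 0] is the tangent at the base point, which only [t = oo] reaches. *)
  exists 0; right.
  have q0 : q = - 3 / 8 * p - 7 / 8 by move: M0; rewrite /M /dx /dy; lra.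
  have p1 : p = 1 / 7.
    have /eqP : (p - 1 / 7) ^+ 2 = 0 by move: p2; rewrite q0; nra.
    by rewrite sqrf_eq0 subr_eq0 => /eqP.
  have q1 : q = - 13 / 14 by rewrite q0 p1; field.
  by rewrite p1 q1 /x1 /x2 /x3; split; field.
exists (N / M); left.
(* The left side is [49 * (dx ^+ 2 + dx * dy + dy ^+ 2)], and the conic recentred at the base point
   reads [dx ^+ 2 + dx * dy + dy ^+ 2 = 3 / 14 * M]. *)
have D : N ^+ 2 + N * M + M ^+ 2 = 21 / 2 * M.
  apply/eqP; rewrite -subr_eq0; apply/eqP.
  transitivity (49 * (p ^+ 2 + p * q + q ^+ 2 - 3 / 4)).
    by rewrite /M /N /dx /dy; field.
  by rewrite p2; ring.
have tE : (N / M) ^+ 2 + N / M + 1 = 21 / 2 / M.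
  transitivity ((N ^+ 2 + N * M + M ^+ 2) / M ^+ 2); first by field.
  by rewrite D; field.
have num (k l m : rat) : (k * (N / M) ^+ 2 + l * (N / M) + m) / (14 * (21 / 2 / M))
    = (k * N ^+ 2 + l * N * M + m * M ^+ 2) / (147 * M).
  by field.
have key (k l m z : rat) :
  k * N ^+ 2 + l * N * M + m * M ^+ 2 = 14 * z * (N ^+ 2 + N * M + M ^+ 2) ->
  (k * (N / M) ^+ 2 + l * (N / M) + m) / (14 * (21 / 2 / M)) = z.
  by move=> h; rewrite num h D; field.
(* Each coordinate identity holds modulo the conic equation. The cofactors below come from
   [8 * N + 5 * M = - 49 * dx], [3 * N + 8 * M = 49 * dy] and [686 = 14 * 49]. *)
have conic (z k : rat) : z = k * (p ^+ 2 + p * q + q ^+ 2 - 3 / 4) -> z = 0.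
  by move=> ->; rewrite p2 subrr mulr0.
split; rewrite /x1 /x2 /x3 tE.
- transitivity ((2 * (N / M) ^+ 2 + -22 * (N / M) + -13) / (14 * (21 / 2 / M))).
    by congr (_ / _); ring.
  apply: key; apply/eqP; rewrite -subr_eq0; apply/eqP.
  by apply: (conic _ (- 686 * dx)); rewrite /M /N /dx /dy; field.
- transitivity ((-13 * (N / M) ^+ 2 + -4 * (N / M) + 11) / (14 * (21 / 2 / M))).
    by congr (_ / _); ring.
  apply: key; apply/eqP; rewrite -subr_eq0; apply/eqP.
  by apply: (conic _ (- 686 * dy)); rewrite /M /N /dx /dy; field.
- transitivity ((11 * (N / M) ^+ 2 + 26 * (N / M) + 2) / (14 * (21 / 2 / M))).
    by congr (_ / _); ring.
  apply: key; apply/eqP; rewrite -subr_eq0; apply/eqP.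
  by apply: (conic _ (686 * (dx + dy))); rewrite /M /N /dx /dy; field.
Qed.

Lemma sum_x123 (t : rat) : x1 t + x2 t + x3 t = 0.
Proof.
have t0 : t ^+ 2 + t + 1 != 0 by apply/eqP => ?; nra.
by rewrite /x1 /x2 /x3; field.
Qed.

Lemma sum_sqr_x123 (t : rat) : x1 t ^+ 2 + x2 t ^+ 2 + x3 t ^+ 2 = 3 / 2.
Proof.
have t0 : t ^+ 2 + t + 1 != 0 by apply/eqP => ?; nra.
by rewrite /x1 /x2 /x3; field.
Qed.

(** * The parametrized sets are designs *)

Lemma mem_six_point_set (R : realType) (t : rat) :
  six_point_set R t =i [seq ratr q | q <- six_points t].
Proof.
by move=> x; apply/imfsetP/mapP => -[q qs ->]; exists q.
Qed.

Lemma perm_six_point_set (R : realType) (t : rat) :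
  uniq (six_points t) ->
  perm_eq (six_point_set R t) [seq ratr q | q <- six_points t].
Proof.
move=> ut; apply: uniq_perm; first exact: fset_uniq.
  by rewrite map_inj_uniq//; exact: fmorph_inj.
exact: mem_six_point_set.
Qed.

(* The two equations give [1 - a ^+ 2 = (b - c) ^+ 2 / 3]. *)
Lemma conic_lt1 (R : realFieldType) (a b c : R) :
  a + b + c = 0 -> a ^+ 2 + b ^+ 2 + c ^+ 2 = 3 / 2 -> b != c -> -1 < a < 1.
Proof.
move=> s1 s2 bc; have aE : a = - b - c by lra.
have : 0 < (b - c) ^+ 2 by rewrite exprn_even_gt0//= subr_eq0.
rewrite {}aE {s1} in s2 *; move=> h.
have h1 : (- b - c) ^+ 2 < 1 by nra.
by apply/andP; split; nra.
Qed.

(** The integral condition becomes an identity between coefficients, leaving only algebra in both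
    directions. *)
Lemma chebyshev_designP (R : realType) (X : {fset R}) :
  is_chebyshev_design 5 6 X <->
  [/\ #|` X|%fset = 6, (forall x, x \in X -> x \in `](-1), 1[) &
      forall f : {poly R}, (size f <= 6)%N ->
        6^-1 * (\sum_(x <- X) f.[x]) = f`_0 + f`_2 / 2 + 3 * f`_4 / 8].
Proof.
split=> -[X6 XI Xf]; split=> // f sf.
  by have := Xf f sf; rewrite integral_chebyshev_deg5// => -[].
by rewrite integral_chebyshev_deg5// Xf.
Qed.

Lemma ratr_power_sum (R : realType) (a b c : rat) (n v w : nat) :
  (ratr a ^+ n + ratr b ^+ n + ratr c ^+ n == v%:R / w%:R :> R)
  = (a ^+ n + b ^+ n + c ^+ n == v%:R / w%:R).
Proof.
rewrite -(inj_eq (@fmorph_inj _ _ (@ratr R))) fmorph_div !rmorph_nat.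
by rewrite !rmorphD !rmorphXn.
Qed.

(** Distinctness keeps the points inside the open interval: if two of the three coordinates agreed,
    the third would be [1] or [-1]. *)
Lemma six_points_lt1 (t q : rat) :
  uniq (six_points t) -> q \in six_points t -> -1 < q < 1.
Proof.
rewrite /six_points; move: (sum_x123 t) (sum_sqr_x123 t).
move: (x1 t) (x2 t) (x3 t) => a b c s1 s2 /=.
rewrite !inE !negb_or => /andP[/and3P[ab ac _] /andP[/andP[bc _] _]].
have a1 : -1 < a < 1 by exact: conic_lt1 s1 s2 bc.
have b1 : -1 < b < 1.
  by apply: (conic_lt1 _ _ ac); [rewrite -s1|rewrite -s2]; ring.
have c1 : -1 < c < 1.
  by apply: (conic_lt1 _ _ ab); [rewrite -s1|rewrite -s2]; ring.
by case/or4P=> [/eqP->|/eqP->|/eqP->|/or3P[]/eqP->] //; lra.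
Qed.

Lemma six_point_set_design (R : realType) (t : rat) :
  uniq (six_points t) -> is_chebyshev_design 5 6 (six_point_set R t).
Proof.
move=> ut; apply/chebyshev_designP.
have pX := perm_six_point_set R ut; split.
- exact: perm_size pX.
- move=> x; rewrite mem_six_point_set => /mapP[q /(six_points_lt1 ut) /andP[q1 q2] ->].
  rewrite in_itv/= -(ltr_rat R) rmorphN rmorph1 in q1 *.
  by rewrite q1 -(ltr_rat R) rmorph1 in q2 *.
- move=> f sf; rewrite (perm_big _ pX)/=.
  have p2 : x1 t ^+ 2 + x2 t ^+ 2 + x3 t ^+ 2 = 3 / 2 by exact: sum_sqr_x123.
  (* For three numbers with sum zero, the fourth power sum is half the square of the second. *)
  have p4 : x1 t ^+ 4 + x2 t ^+ 4 + x3 t ^+ 4 = 9 / 8.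
    move: (x1 t) (x2 t) (x3 t) (sum_x123 t) p2 => a b c s1.
    have {s1}-> : c = - a - b by lra.
    move=> p2; transitivity ((a ^+ 2 + b ^+ 2 + (- a - b) ^+ 2) ^+ 2 / 2).
      by field.
    by rewrite p2; field.
  move/eqP: p2; move/eqP: p4; rewrite -!(ratr_power_sum R) => /eqP p4 /eqP p2.
  move: (x1 t) (x2 t) (x3 t) p2 p4 => {pX ut t} a b c.
  rewrite !big_cons big_nil !raddfN/= !(horner_deg5 _ sf).
  move: (ratr a) (ratr b) (ratr c) => {}a {}b {}c p2 p4.
  (* Odd powers cancel between opposite points and even powers count twice, so [6^-1] turns into
     [1 / 3]. *)
  transitivity (f`_0 + f`_2 * (a ^+ 2 + b ^+ 2 + c ^+ 2) / 3
     + f`_4 * (a ^+ 4 + b ^+ 4 + c ^+ 4) / 3); first by field.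
  by rewrite p2 p4; field.
Qed.

(** * Every rational design is parametrized *)

Lemma design_points (R : realType) (X : {fset R}) :
  is_chebyshev_design 5 6 X ->
  exists a b c : R, [/\ a + b + c = 0, a ^+ 2 + b ^+ 2 + c ^+ 2 = 3 / 2 &
    X =i [:: a; b; c; - a; - b; - c]].
Proof.
move=> /chebyshev_designP[X6 _ Xf].
pose s := sort <=%R X.
have sX : perm_eq s X by exact/permPl/perm_sort.
have ss : sorted <%R s.
  by rewrite lt_sorted_uniq_le sort_uniq fset_uniq sort_sorted//; exact: le_total.
(* Testing the design on ['X^k] gives power sums 3 and 9/4 for [k = 2, 4], and 0 for odd [k]. *)
have ps k : (k < 6)%N -> \sum_(x <- s) x ^+ k =
    6 * ((0 == k)%:R + (2 == k)%:R / 2 + 3 * (4 == k)%:R / 8).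
  move=> k6; rewrite (perm_big _ sX)/=.
  have := Xf 'X^k; rewrite size_polyXn => /(_ k6); rewrite !coefXn => <-.
  rewrite mulrA divff ?mul1r ?pnatr_eq0//.
  by apply: eq_bigr => x _; rewrite hornerXn.
have mX : X =i s by move=> x; rewrite (perm_mem sX).
have : size s = 6 by rewrite (perm_size sX).
move: s ss ps mX {sX} => [//|a [//|b [//|c [//|d [//|e [//|f [|//]]]]]]] ss ps mX _.
have p1 := ps 1%N isT; have p2 := ps 2%N isT; have p3 := ps 3%N isT.
have p4 := ps 4%N isT; have p5 := ps 5%N isT.
rewrite !big_cons !big_nil/= in p1 p2 p3 p4 p5.
have pP : forall x, (x + a) * (x + b) * (x + c) * (x + d) * (x + e) * (x + f)
    = (x - a) * (x - b) * (x - c) * (x - d) * (x - e) * (x - f).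
  by apply: odd_power_sums_prod; [move: p1|move: p3|move: p5]; lra.
(* The points are the roots of a monic polynomial that [pP] shows to be even, so they are closed
   under negation; sorting then forces [d = - c], [e = - b], [f = - a]. *)
have memE x : (x \in [:: a; b; c; d; e; f])
    = ((x - a) * (x - b) * (x - c) * (x - d) * (x - e) * (x - f) == 0).
  by rewrite !mulf_eq0 !subr_eq0 !inE -!orbA.
have sN : {in [:: a; b; c; d; e; f], forall x, - x \in [:: a; b; c; d; e; f]}.
  move=> x; rewrite !memE -pP => /eqP h; apply/eqP; rewrite -[RHS]h; ring.
have [_ _ _ dE eE fE] := lt_sorted_symmetric ss sN.
rewrite {}dE {}eE {}fE in p2 p4 mX *.
have q2 : a ^+ 2 + b ^+ 2 + c ^+ 2 = 3 / 2 by move: p2; lra.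
have q4 : a ^+ 4 + b ^+ 4 + c ^+ 4 = 9 / 8 by move: p4; lra.
(* The sign in each linear relation is absorbed by exchanging a point with its opposite, which
   leaves the set unchanged. *)
have [h|h|h|h] := power_sums_linear q2 q4.
- exists a, b, c; split=> // x; rewrite mX !inE; do !case: eqP => //.
- exists a, b, (- c); split; rewrite ?sqrrN// => x.
  by rewrite mX !inE opprK; do !case: eqP => //.
- exists a, (- b), c; split; rewrite ?sqrrN// => x.
  by rewrite mX !inE opprK; do !case: eqP => //.
- exists (- a), b, c; split; rewrite ?sqrrN// => x.
  by rewrite mX !inE opprK; do !case: eqP => //.
Qed.

Lemma rational_design_param (R : realType) (X : {fset R}) :
  is_chebyshev_design 5 6 X -> rational_points X ->
  exists t : rat, X = six_point_set R t.
Proof.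
move=> /design_points[a [b [c [s1 s2 mX]]]] rX.
have [p pE] : exists q, a = ratr q by apply: rX; rewrite mX !inE eqxx.
have [q qE] : exists q, b = ratr q by apply: rX; rewrite mX !inE eqxx !orbT.
have [r rE] : exists q, c = ratr q by apply: rX; rewrite mX !inE eqxx !orbT.
rewrite {}pE {}qE {}rE {a b c} in s1 s2 mX.
have {}s1 : p + q + r = 0.
  by apply: (@fmorph_inj _ _ (@ratr R)); rewrite !rmorphD rmorph0.
have {}s2 : p ^+ 2 + q ^+ 2 + r ^+ 2 = 3 / 2.
  by apply/eqP; rewrite -(ratr_power_sum R); apply/eqP.
have [t tE] := conic_param s1 s2.
exists t; apply/fsetP => x; rewrite mem_six_point_set mX /six_points.
(* In the second case the coordinates are cyclically shifted, which lists the same six points. *)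
case: tE => -[-> -> ->]; rewrite /= !raddfN/= !inE //.
by do !case: eqP => //.
Qed.

Theorem theorem1p3 (R : realType) :
  (forall X : {fset R},
     is_chebyshev_design 5 6 X -> rational_points X ->
     exists t : rat, X = six_point_set R t) /\
  (forall t : rat, uniq (six_points t) ->
     is_chebyshev_design 5 6 (six_point_set R t) /\
     rational_points (six_point_set R t)).
Proof.
split=> [X|t ut]; first exact: rational_design_param.
split=> [|x]; first exact: six_point_set_design.
by rewrite mem_six_point_set => /mapP[q _ ->]; exists q.
Qed.
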